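(* Let $n\geq 1$, $\ell\geq 1$ and $k\geq 2$ be integers. The maximal distance $D_{n,\ell,k}=\max_{t_1,\ldots,t_k\in\mathcal{T}_{n,\ell}} d(t_1,t_2,\ldots,t_k)$ of $k$ sequence patterns of length $n$ and level $\ell$ is $$D_{n,\ell,k} = n - \left\lceil \frac{n}{\ell^{k-1}}\right\rceil .$$
   Context: Let $N=\{1,\ldots,n\}$ and $L=\{1,\ldots,\ell\}$. A length-$n$ level-$\ell$ sequence is a function $q:N\to L$; the set of all such sequences is $\mathcal{Q}_{n,\ell}$. The symmetric group $S_\ell$ acts on $\mathcal{Q}_{n,\ell}$ by relabeling symbols: $\phi(q)=\phi\circ q$. A length-$n$ level-$\ell$ sequence pattern is an orbit (equivalence class) of this action, and $\mathcal{T}_{n,\ell}$ is the set of all sequence patterns. For $q_1,\ldots,q_k\in\mathcal{Q}_{n,\ell}$, the Hamming distance $d(q_1,\ldots,q_k)$ is the number of indices $i\in N$ such that $q_1(i),\ldots,q_k(i)$ are not all equal. For $t_1,\ldots,t_k\in\mathcal{T}_{n,\ell}$, the distance is $d(t_1,\ldots,t_k)=\min\{d(q_1,\ldots,q_k) : q_j\in t_j \text{ for } 1\le j\le k\}$. The patterns $t_1,\ldots,t_k$ in the maximum are arbitrary elements of $\mathcal{T}_{n,\ell}$ (repetitions are allowed). *)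

(* Defs.v *)
From mathcomp Require Import all_boot all_order all_algebra all_fingroup.

Set Implicit Arguments.
Unset Strict Implicit.
Unset Printing Implicit Defensive.

(* Positions 1..n and symbols 1..l are encoded as 'I_n and 'I_l. *)
Definition relabel (n l : nat) (q : {ffun 'I_n -> 'I_l}) (phi : 'S_l) :
    {ffun 'I_n -> 'I_l} :=
  [ffun i => phi (q i)].

(* In MathComp (phi * psi) x = psi (phi x), so post-composition is a right
   action. *)
Lemma relabel1 n l : @relabel n l ^~ 1%g =1 id.
Proof. by move=> q; apply/ffunP=> i; rewrite ffunE perm1. Qed.

Lemma relabelM n l (q : {ffun 'I_n -> 'I_l}) :
  act_morph (@relabel n l) q.
Proof. by move=> phi psi; apply/ffunP=> i; rewrite !ffunE permM. Qed.

Canonical relabel_action (n l : nat) := TotalAction (@relabel1 n l) (@relabelM n l).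

Definition patterns (n l : nat) : {set {set {ffun 'I_n -> 'I_l}}} :=
  [set orbit (relabel_action n l) [set: 'S_l] q | q : {ffun 'I_n -> 'I_l}].

Definition hamming (n l k : nat) (q : {ffun 'I_k -> {ffun 'I_n -> 'I_l}}) : nat :=
  #|[set i : 'I_n | ~~ [forall a : 'I_k, forall b : 'I_k, q a i == q b i]]|.

(* Every Hamming distance is at most n, so the default value n of the iterated
   minimum does not change the minimum over a nonempty family. *)
Definition pattern_dist (n l k : nat)
    (t : {ffun 'I_k -> {set {ffun 'I_n -> 'I_l}}}) : nat :=
  \big[minn/n]_(q : {ffun 'I_k -> {ffun 'I_n -> 'I_l}} | [forall j, q j \in t j])
     hamming q.

(* For l >= 1 the maximum is over a nonempty family. *)
Definition max_pattern_dist (n l k : nat) : nat :=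
  \max_(t : {ffun 'I_k -> {set {ffun 'I_n -> 'I_l}}} |
         [forall j, t j \in patterns n l])
     pattern_dist t.

(* Main.v *)
Require Import Defs.
From mathcomp Require Import all_boot all_order all_algebra all_fingroup.

(** Fix the first sequence and let each of the other [k - 1] be shifted modulo
    [l]: every position is a common agreement for exactly one of the
    [l ^ (k - 1)] choices of shifts, so by pigeonhole some choice has at least
    [n / l ^ (k - 1)] agreements.  Conversely, let the first sequence be constant
    and let the other [k - 1] run periodically through all [l ^ (k - 1)] columns:
    whatever the relabelings, the common symbol is that of the first sequence, so
    all agreements lie in one residue class modulo [l ^ (k - 1)]. *)

Set Implicit Arguments.
Unset Strict Implicit.
Unset Printing Implicit Defensive.

Import GRing.Theory Num.Theory Order.TTheory.

Definition agreement n l k (q : {ffun 'I_k -> {ffun 'I_n -> 'I_l}}) : {set 'I_n} :=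
  [set i | [forall a, forall b, q a i == q b i]].

Lemma hammingE n l k (q : {ffun 'I_k -> {ffun 'I_n -> 'I_l}}) :
  hamming q = n - #|agreement q|.
Proof.
rewrite /hamming cardsCs card_ord; congr (n - #|pred_of_set _|).
by apply/setP => i; rewrite !inE negbK.
Qed.

(** Equality is transitive, so comparing with the first sequence suffices; [lift ord0] runs through
    the others. *)
Lemma mem_agreement n l k (q : {ffun 'I_k.+1 -> {ffun 'I_n -> 'I_l}}) i :
  (i \in agreement q) = [forall j, q (lift ord0 j) i == q ord0 i].
Proof.
rewrite inE; apply/forallP/forallP => [H j|H a]; first exact: (forallP (H _)).
have E c : q c i = q ord0 i.
  by case: (unliftP ord0 c) => [j|] ->; first exact/eqP/H.
by apply/forallP => b; rewrite !E.
Qed.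

Lemma pigeonhole_fiber (T U : finType) (f : T -> U) :
  0 < #|T| -> exists u, #|T| <= #|U| * #|[set x | f x == u]|.
Proof.
move=> /card_gt0P[x0 _].
have T_sum : #|T| = \sum_u #|[set x | f x == u]|.
  rewrite -sum1_card (partition_big f xpredT) //=; apply: eq_bigr => u _.
  by rewrite -sum1_card; apply: eq_bigl => x; rewrite inE.
case: (@arg_maxnP _ (f x0) xpredT (fun u => #|[set x | f x == u]|)) => // u _ u_max.
exists u; rewrite {1}T_sum -sum_nat_const.
by apply: leq_sum => v _; apply: u_max.
Qed.

(** Within one residue class modulo [m], an index is determined by its quotient [i %/ m], which is
    at most [n.-1 %/ m]. *)
Lemma card_residue_class n m r :
  0 < n -> 0 < m -> #|[set i : 'I_n | i %% m == r]| <= (n.-1 %/ m).+1.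
Proof.
move=> n_gt0 m_gt0; pose f (i : 'I_n) : 'I_(n.-1 %/ m).+1 := inord (i %/ m).
have fE i : f i = i %/ m :> nat.
  by rewrite inordK // ltnS leq_div2r // -ltnS prednK.
rewrite -[X in _ <= X]card_ord -(@card_in_imset _ _ f) ?max_card //.
move=> i j; rewrite !inE => /eqP ir /eqP jr /(congr1 val) /=.
by rewrite !fE => eq_div; apply/val_inj; rewrite /= (divn_eq i m) (divn_eq j m) ir jr eq_div.
Qed.

(** This form of the ceiling lets all counting stay in the natural numbers. *)
Lemma ceil_ratio n m : 0 < n -> 0 < m ->
  Num.ceil ((n%:R : rat) / m%:R)%R = Posz (n.-1 %/ m).+1.
Proof.
move=> n_gt0 m_gt0; apply: Num.Theory.ceil_def.
have m_gt0R : (0 < m%:R :> rat)%R by rewrite ltr0n.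
rewrite ltr_pdivlMr // ler_pdivrMr //.
have -> : (Posz (n.-1 %/ m).+1 - 1)%R = Posz (n.-1 %/ m) by rewrite intS addrC addKr.
rewrite -!pmulrn -!natrM ltr_nat ler_nat.
by rewrite -{2 3}(prednK n_gt0) ltn_ceil // ltnS leq_divM.
Qed.

Definition shift l (a : 'I_l.+1) : 'S_l.+1 := perm (@addrI _ a).

Lemma exists_large_agreement n l k (q : {ffun 'I_k.+1 -> {ffun 'I_n -> 'I_l.+1}}) :
  0 < n -> exists phi : 'I_k.+1 -> 'S_l.+1,
    n <= l.+1 ^ k * #|agreement [ffun j => relabel (q j) (phi j)]|.
Proof.
move=> n_gt0.
(* [f i] lists the only shifts that carry the other symbols at position [i] onto the first one. *)
pose f i := [ffun j : 'I_k => (q ord0 i - q (lift ord0 j) i)%R].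
have [|s] := @pigeonhole_fiber _ _ f; first by rewrite card_ord.
rewrite card_ffun !card_ord => le_n.
exists (fun j => if unlift ord0 j is Some j' then shift (s j') else 1%g).
apply: leq_trans le_n _; rewrite leq_mul2l subset_leq_card ?orbT //.
apply/subsetP => i; rewrite mem_agreement inE => /eqP <-.
apply/forallP => j; rewrite !ffunE liftK unlift_none permE perm1 ffunE.
by rewrite subrK.
Qed.

Lemma pattern_dist_le n l k (t : {ffun 'I_k.+1 -> {set {ffun 'I_n -> 'I_l.+1}}}) :
  0 < n -> (forall j, t j \in patterns n l.+1) ->
  pattern_dist t <= n - (n.-1 %/ l.+1 ^ k).+1.
Proof.
move=> n_gt0 t_pat.
have /fin_all_exists[q tE] j : exists q, t j = orbit (relabel_action n l.+1) setT q.
  by have /imsetP[q _ ->] := t_pat j; exists q.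
have [phi le_n] := @exists_large_agreement _ _ _ (finfun q) n_gt0.
apply: (@leq_trans (hamming [ffun j => relabel (finfun q j) (phi j)])).
  rewrite -leEnat /pattern_dist -minEnat; apply: bigmin_le_cond; apply/forallP => j; rewrite tE !ffunE.
  exact: (mem_orbit (relabel_action n l.+1)).
rewrite hammingE leq_sub2l // ltn_divLR ?expn_gt0 //.
by rewrite mulnC (leq_trans _ le_n) // prednK.
Qed.

Lemma exists_small_agreement n l k :
  0 < n -> exists q : {ffun 'I_k.+1 -> {ffun 'I_n -> 'I_l.+1}},
    forall phi : 'I_k.+1 -> 'S_l.+1,
      #|agreement [ffun j => relabel (q j) (phi j)]| <= (n.-1 %/ l.+1 ^ k).+1.
Proof.
move=> n_gt0.
have M_gt0 : 0 < l.+1 ^ k by rewrite expn_gt0.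
have cardM : l.+1 ^ k = #|{ffun 'I_k -> 'I_l.+1}| by rewrite card_ffun !card_ord.
(* Position [i] receives the column of index [i %% l.+1 ^ k] in the enumeration of all columns. *)
pose column i : {ffun 'I_k -> 'I_l.+1} :=
  enum_val (cast_ord cardM (Ordinal (ltn_pmod i M_gt0))).
pose q j : {ffun 'I_n -> 'I_l.+1} :=
  if unlift ord0 j is Some j' then [ffun i : 'I_n => column i j'] else [ffun=> ord0].
exists (finfun q) => phi.
(* After relabeling, the constant first sequence shows [phi ord0 ord0] everywhere; agreement at [i]
   forces [column i] to consist of the preimages of that symbol. *)
pose d := [ffun j => ((phi (lift ord0 j))^-1)%g (phi ord0 ord0)].
apply: leq_trans (card_residue_class (cast_ord (esym cardM) (enum_rank d)) n_gt0 M_gt0).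
apply/subset_leq_card/subsetP => i; rewrite mem_agreement inE => /forallP agr.
have <- : column i = d; last by rewrite enum_valK.
apply/ffunP => j; have /eqP := agr j.
by rewrite !ffunE /q liftK unlift_none !ffunE => <-; rewrite permK.
Qed.

Lemma pattern_dist_ge n l k :
  0 < n -> exists2 t : {ffun 'I_k.+1 -> {set {ffun 'I_n -> 'I_l.+1}}},
    forall j, t j \in patterns n l.+1 &
    n - (n.-1 %/ l.+1 ^ k).+1 <= pattern_dist t.
Proof.
move=> /exists_small_agreement-/(_ l k)[q q_small].
exists [ffun j => orbit (relabel_action n l.+1) setT (q j)] => [j|].
  by rewrite ffunE imset_f.
(* The default value [n] of the minimum must satisfy the lower bound too. *)
rewrite -leEnat /pattern_dist -minEnat; apply: le_bigmin => [|r /forallP r_orbit]; first exact: leq_subr.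
have /fin_all_exists[phi rE] j : exists phi, r j = relabel (q j) phi.
  by have := r_orbit j; rewrite ffunE => /orbitP[phi _ <-]; exists phi.
rewrite [X in (_ <= X)%O]hammingE (_ : r = [ffun j => relabel (q j) (phi j)]).
  exact/leq_sub2l/q_small.
by apply/ffunP => j; rewrite ffunE rE.
Qed.

Theorem theorem4 (n l k : nat) (hn : (1 <= n)%N) (hl : (1 <= l)%N)
    (hk : (2 <= k)%N) :
  ((max_pattern_dist n l k)%:Z =
     n%:Z - Num.ceil ((n%:R : rat) / (l%:R : rat) ^+ (k - 1)))%R.
Proof.
case: l hl => // l _; case: k hk => // k _.
rewrite subSS subn0 -natrX ceil_ratio ?expn_gt0 //.
(* This makes truncated subtraction agree with subtraction of integers. *)
have C_le_n : (n.-1 %/ l.+1 ^ k).+1 <= n.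
  by rewrite -[leqRHS](prednK hn) ltnS leq_div.
rewrite subzn //; congr Posz; apply/eqP; rewrite eqn_leq; apply/andP; split.
  by apply/bigmax_leqP => t /forallP; apply: pattern_dist_le.
have [t t_pat le_t] := @pattern_dist_ge n l k hn.
by apply: (leq_trans le_t); apply: leq_bigmax_cond; apply/forallP.
Qed.
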